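(* Let $(\Omega,\mathcal{F})$ be a standard Borel space, let $E$ be an equivalence relation on $\Omega$, and let $\mathcal{G}$ be a sub-$\sigma$-algebra of $\mathcal{F}$. Then the pair $(E,\mathcal{G})$ satisfies strong duality if and only if $E$ is measurable (that is, $E\in\mathcal{F}\otimes\mathcal{F}$) and $(E,\mathcal{G})$ satisfies quasi-strong duality.
   Context: $\mathcal{P}(\Omega,\mathcal{F})$ is the set of probability measures on $(\Omega,\mathcal{F})$, and $\Pi(\mathbb{P},\mathbb{P}')$ is the set of couplings, i.e. probability measures on $(\Omega\times\Omega,\mathcal{F}\otimes\mathcal{F})$ with first marginal $\mathbb{P}$ and second marginal $\mathbb{P}'$. The pair $(E,\mathcal{G})$ satisfies strong duality if $E\in\mathcal{F}\otimes\mathcal{F}$ and, for all $\mathbb{P},\mathbb{P}'\in\mathcal{P}(\Omega,\mathcal{F})$, $$\max_{A\in\mathcal{G}}|\mathbb{P}(A)-\mathbb{P}'(A)|=\min_{\tilde{\mathbb{P}}\in\Pi(\mathbb{P},\mathbb{P}')}(1-\tilde{\mathbb{P}}(E)),$$ where max and min assert that the supremum and infimum are both attained. The pair $(E,\mathcal{G})$ satisfies quasi-strong duality if, for all $\mathbb{P},\mathbb{P}'\in\mathcal{P}(\Omega,\mathcal{F})$, the following are equivalent: (i) $\mathbb{P}(A)=\mathbb{P}'(A)$ for all $A\in\mathcal{G}$; (ii) there exist $\tilde{\mathbb{P}}\in\Pi(\mathbb{P},\mathbb{P}')$ and $N\in\mathcal{F}\otimes\mathcal{F}$ with $\tilde{\mathbb{P}}(N)=0$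 and $(\Omega\times\Omega)\setminus E\subseteq N$. (Measurability of $E$ is not required for quasi-strong duality.) *)

(* Defs.v *)
From mathcomp Require Import all_boot all_order all_algebra.
From mathcomp Require Import all_classical all_reals all_analysis.

Set Implicit Arguments.
Unset Strict Implicit.
Unset Printing Implicit Defensive.

Import Order.TTheory GRing.Theory Num.Theory.

Local Open Scope classical_set_scope.
Local Open Scope ring_scope.
Local Open Scope ereal_scope.

(* The axiom [cauchy_cvg] of [completeType], stated as a predicate so that it
   applies to a [metricType], for which the library has no complete version. *)
Definition complete_space (X : uniformType) : Prop :=
  forall F : set_system X, ProperFilter F -> cauchy F -> exists x : X, F --> x.

Definition separable_space (X : topologicalType) : Prop :=
  exists2 S : set X, countable S & dense S.

(* [T] is isomorphic, as a measurable space, to the Borel space of a complete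
   separable metric space: for bijective [f], the last clause says that both
   [f] and its inverse are measurable. *)
Definition standard_borel (R : realType) (d : measure_display)
    (T : measurableType d) : Prop :=
  exists (X : metricType R) (f : T -> X),
    [/\ complete_space X, separable_space X, bijective f &
        forall B : set X, <<s open >> B <-> measurable (f @^-1` B)].

Definition is_sub_sigma_algebra (d : measure_display) (T : measurableType d)
    (G : set (set T)) : Prop :=
  sigma_algebra [set: T] G /\ G `<=` measurable.

Definition coupling (R : realType) (d : measure_display)
    (T : measurableType d) (P P' : probability T R) :
    set (probability (T * T)%type R) :=
  [set Q | forall A : set T, measurable A ->
     pushforward Q fst A = P A /\ pushforward Q snd A = P' A].

Definition is_max (R : realType) (S : set (\bar R)) (v : \bar R) : Prop :=
  S v /\ ubound S v.

Definition is_min (R : realType) (S : set (\bar R)) (v : \bar R) : Prop :=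
  S v /\ lbound S v.

Definition strong_duality (R : realType) (d : measure_display)
    (T : measurableType d) (E : set (T * T)) (G : set (set T)) : Prop :=
  measurable E /\
  forall P P' : probability T R, exists v : \bar R,
    is_max [set `|P A - P' A| | A in G] v /\
    is_min [set 1 - Q E | Q in coupling P P'] v.

Definition quasi_strong_duality (R : realType) (d : measure_display)
    (T : measurableType d) (E : set (T * T)) (G : set (set T)) : Prop :=
  forall P P' : probability T R,
    (forall A : set T, G A -> P A = P' A) <->
    (exists2 Q : probability (T * T)%type R,
       coupling P P' Q & Q.-negligible (~` E)).

(* Main.v *)
From HB Require Import structures.
Require Import Defs.
From mathcomp Require Import all_boot all_order all_algebra.
From mathcomp Require Import all_classical all_reals all_analysis.
From mathcomp Require Import measurable_realfun ring lra.

(** For the implication from quasi-strong to strong duality, Dirac masses show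
    that every A in G is E-invariant, so that P(A) - P'(A) <= 1 - Q(E) for every
    coupling Q: a pair with first component in A and second outside A cannot lie
    in E. To attain equality, let a and b be the densities on G of P and P' with
    respect to P + P'. The measures min(1, b/a).P and min(1, a/b).P' agree on G,
    and their common mass is 1 - (P(A) - P'(A)) for A = {b <= a}. Quasi-strong
    duality, applied to their normalizations, couples them inside E; coupling
    the remainders independently gives a Q with 1 - Q(E) <= P(A) - P'(A). *)

Set Implicit Arguments.
Unset Strict Implicit.
Unset Printing Implicit Defensive.

Import Order.TTheory GRing.Theory Num.Theory.

Local Open Scope classical_set_scope.
Local Open Scope ring_scope.
Local Open Scope ereal_scope.

(** * Densities, normalization and mixtures of measures *)

Lemma density_measure (R : realType) (d : measure_display)
    (T : measurableType d) (mu : {measure set T -> \bar R}) (g : T -> \bar R) :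
  measurable_fun setT g -> (forall x, 0 <= g x) ->
  exists nu : {measure set T -> \bar R},
    forall A, nu A = \int[mu]_(x in A) g x.
Proof.
move=> mg g0; pose f A := \int[mu]_(x in A) g x.
have f0 : f set0 = 0 by rewrite /f integral_set0.
have fge0 A : 0 <= f A by exact: integral_ge0.
have fsa : semi_sigma_additive f by exact: semi_sigma_additive_nng_induced.
pose nu : {measure set T -> \bar R} :=
  HB.pack f (isMeasure.Build _ _ _ f f0 fge0 fsa).
by exists nu.
Qed.

(** For null mass [mnormalize] returns the default [P], but the factor [mu setT] is then 0, so the
    product still recovers [mu]. *)
Lemma mnormalizeK (R : realType) (d : measure_display) (T : measurableType d)
    (mu : {measure set T -> \bar R}) (P : probability T R) (A : set T) :
  mu setT < +oo -> measurable A -> mu setT * mnormalize mu P A = mu A.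
Proof.
move=> muoo mA; rewrite /mnormalize.
have [/eqP mu0|mu0] /= := boolP (mu setT == 0).
  rewrite mu0 mul0e; apply/esym/eqP; rewrite -measure_le0 -mu0.
  by apply: le_measure; rewrite ?inE.
rewrite (lt_eqF muoo).
have mufin : mu setT \is a fin_num by rewrite ge0_fin_numE.
rewrite muleCA -[X in _ * (X * _)](fineK mufin) -EFinM divff ?mule1//.
by rewrite fine_eq0.
Qed.

Lemma mixture_probability (R : realType) (d : measure_display)
    (T : measurableType d) (p : \bar R) (P Q : probability T R) :
  0 <= p <= 1 ->
  exists M : probability T R, forall A, M A = p * P A + (1 - p) * Q A.
Proof.
move: p => [p| |]; rewrite ?leye_eq ?andbF// !lee_fin => /andP[p0 p1].
have q0 : (0 <= 1 - p)%R by rewrite subr_ge0.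
pose m := measure_add (mscale (NngNum p0) P) (mscale (NngNum q0) Q).
have mE A : m A = p%:E * P A + (1 - p%:E) * Q A by rewrite /m measure_addE.
have m1 : m setT = 1.
  by rewrite mE !probability_setT !mule1 -EFinB -EFinD addrC subrK.
pose M : probability T R :=
  HB.pack (m : set T -> \bar R) (Measure.class m)
    (Measure_isProbability.Build _ _ _ m m1).
by exists M.
Qed.

(* [a `^ (-1)] is [a^-1], but [powR] comes with a measurability lemma. *)
Lemma min1_divK (R : realType) (a b : R) : (0 <= a -> 0 <= b ->
  Num.min 1 (b * a `^ (-1)) * a = Num.min a b)%R.
Proof.
move=> a0 b0; rewrite powR_inv1//.
have [->|a_neq0] := eqVneq a 0%R; first by rewrite mulr0 min_l.
by rewrite minr_pMl// mul1r divfK.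
Qed.

(** * Common part of two probability measures *)

(** Both weighted measures have density min(a, b) with respect to [P] + [P']. The space [S] is
    arbitrary so that it can later carry the sigma-algebra [G], which makes the weights and [A]
    measurable for [G]. *)
Lemma probability_overlap (R : realType) (d : measure_display)
    (S : measurableType d) (P P' : probability S R) :
  exists (g g' : S -> R) (A : set S),
    [/\ measurable_fun setT g /\ (forall x, 0 <= g x <= 1)%R,
        measurable_fun setT g' /\ (forall x, 0 <= g' x <= 1)%R,
        forall B, measurable B ->
          \int[P]_(x in B) (g x)%:E = \int[P']_(x in B) (g' x)%:E,
        measurable A &
        1 - \int[P]_x (g x)%:E = P A - P' A].
Proof.
pose lam := measure_add P P'.
have lamE A : lam A = P A + P' A by rewrite /lam measure_addE.
have lam_fin : fin_num_fun lam.
  by move=> A mA; rewrite /= lamE fin_numD !fin_num_measure.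
pose la : {finite_measure set S -> \bar R} :=
  HB.pack (lam : set S -> \bar R) (Measure.class lam)
    (Measure_isFinite.Build _ _ _ lam lam_fin).
have Pla : P `<< la.
  apply/null_content_dominatesP => A mA /eqP.
  by rewrite [X in X == _](lamE A) padde_eq0// => /andP[/eqP].
have P'la : P' `<< la.
  apply/null_content_dominatesP => A mA /eqP.
  by rewrite [X in X == _](lamE A) padde_eq0// => /andP[_ /eqP].
pose rn (Q : probability S R) := Radon_Nikodym_SigmaFinite.f Q la.
have density (Q : probability S R) : Q `<< la -> exists a : S -> R,
    [/\ measurable_fun setT a, forall x, (0 <= a x)%R,
        forall B, measurable B -> Q B = \int[la]_(x in B) (a x)%:E &
        forall (f : S -> R) B, measurable B -> measurable_fun setT f ->
          (forall x, (0 <= f x)%R) ->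
          \int[Q]_(x in B) (f x)%:E = \int[la]_(x in B) (f x * a x)%:E].
  (* The derivative is finite everywhere, so [fine] yields a real-valued density without changing
     it. *)
  move=> Qla; have rnE x : (fine (rn Q x))%:E = rn Q x.
    by rewrite fineK// Radon_Nikodym_SigmaFinite.f_fin_num.
  exists (fine \o rn Q); split.
  - apply: measurableT_comp => //.
    exact: measurable_int (Radon_Nikodym_SigmaFinite.f_integrable Qla).
  - by move=> x; exact/fine_ge0/Radon_Nikodym_SigmaFinite.f_ge0.
  - move=> B mB; rewrite (Radon_Nikodym_SigmaFinite.f_integral Qla mB).
    by apply: eq_integral => x _; rewrite rnE.
  - move=> f B mB mf f0.
    rewrite -(Radon_Nikodym_SigmaFinite.change_of_variables Qla)//.
    + by apply: eq_integral => x _; rewrite EFinM rnE.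
    + exact/measurable_EFinP/measurable_funTS.
have [a [ma a0 PE aE]] := density _ Pla.
have [b [mb b0 P'E bE]] := density _ P'la.
(* This is min(1, v/u), with value 0 where [u] vanishes; for nonnegative [u] and [v], multiplying by
   [u] gives min(u, v) at every point. *)
pose w (u v : S -> R) x := (Num.min 1 (v x * u x `^ (-1)))%R.
have mw u v : measurable_fun setT u -> measurable_fun setT v ->
    measurable_fun setT (w u v).
  move=> mu mv; apply: measurable_minr => //; apply: measurable_funM => //.
  exact: measurableT_comp (measurable_powR _) mu.
have w01 u v : (forall x, (0 <= v x)%R) -> forall x, (0 <= w u v x <= 1)%R.
  move=> v0 x; rewrite /w ge_min lexx andbT le_min ler01/=.
  by rewrite mulr_ge0// powR_ge0.
have w0 u v : (forall x, (0 <= v x)%R) -> forall x, (0 <= w u v x)%R.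
  by move=> v0 x; have /andP[] := w01 u v v0 x.
have intPE B : measurable B ->
    \int[P]_(x in B) (w a b x)%:E = \int[la]_(x in B) (Num.min (a x) (b x))%:E.
  move=> mB; rewrite aE//; [|exact: mw|exact: w0].
  by apply: eq_integral => x _; rewrite min1_divK.
have intP'E B : measurable B ->
    \int[P']_(x in B) (w b a x)%:E = \int[la]_(x in B) (Num.min (a x) (b x))%:E.
  move=> mB; rewrite bE//; [|exact: mw|exact: w0].
  by apply: eq_integral => x _; rewrite min1_divK// minC.
pose A := [set x | (b x <= a x)%R].
have mA : measurable A.
  by rewrite -[A]setTI; exact: measurable_fun_le.
exists (w a b), (w b a), A; split => //.
- by split; [exact: mw|exact: w01].
- by split; [exact: mw|exact: w01].
- by move=> B mB; rewrite intPE// intP'E.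
(* On [A] the minimum is [b], off [A] it is [a], so the common mass is P'(A) + 1 - P(A). *)
- rewrite intPE// -(setUv A) ge0_integral_setU//.
  + rewrite (eq_integral (fun x => (b x)%:E)); last first.
      by move=> x; rewrite inE /A/= => /min_r ->.
    rewrite [X in _ - (_ + X)](eq_integral (fun x => (a x)%:E)); last first.
      move=> x; rewrite inE /A/= => /negP; rewrite -ltNge => /ltW ab.
      by rewrite min_l.
    rewrite -PE; last exact: measurableC.
    rewrite -P'E// probability_setC//.
    have PA := fin_num_measure P A mA; have P'A := fin_num_measure P' A mA.
    rewrite -(fineK PA) -(fineK P'A) -!EFinB.
    by congr EFin; ring.
  + exact: measurableC.
  + apply/measurable_EFinP/measurable_funTS; exact: measurable_minr.
  + by move=> x _; rewrite lee_fin le_min a0 b0.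
  + exact/disj_setPCl.
Qed.

(** [P] is the sum of its parts with densities g and 1 - g, and each part is its mass times its
    normalization. The default [D] is a parameter so that two splits can share it. *)
Lemma probability_density_split (R : realType) (d : measure_display)
    (T : measurableType d) (P D : probability T R) (g : T -> R) :
  measurable_fun setT g -> (forall x, 0 <= g x <= 1)%R ->
  exists (mu : {measure set T -> \bar R}) (P2 : probability T R),
    [/\ forall A, mu A = \int[P]_(x in A) (g x)%:E, mu setT <= 1 &
        forall A, measurable A ->
          P A = mu setT * mnormalize mu D A + (1 - mu setT) * P2 A].
Proof.
move=> mg g01; pose h x := (1 - g x)%R.
have mh : measurable_fun setT h by exact: measurable_funB.
have g0 x : (0 <= g x)%R by have /andP[] := g01 x.
have h0 x : (0 <= h x)%R by rewrite subr_ge0; have /andP[] := g01 x.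
have [mu muE] : exists nu : {measure set T -> \bar R},
    forall A, nu A = \int[P]_(x in A) (g x)%:E.
  by apply: density_measure => [|x]; [exact/measurable_EFinP|rewrite lee_fin].
have [nu nuE] : exists nu : {measure set T -> \bar R},
    forall A, nu A = \int[P]_(x in A) (h x)%:E.
  by apply: density_measure => [|x]; [exact/measurable_EFinP|rewrite lee_fin].
have munu A : measurable A -> mu A + nu A = P A.
  move=> mA; rewrite muE nuE -ge0_integralD//.
  - under eq_integral do rewrite -EFinD addrC subrK.
    by rewrite integral_cst// mul1e.
  - by move=> x _; rewrite lee_fin.
  - exact/measurable_EFinP/measurable_funTS.
  - by move=> x _; rewrite lee_fin.
  - exact/measurable_EFinP/measurable_funTS.
have mu1 : mu setT <= 1 by rewrite -(probability_setT P) -munu// leeDl.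
have muoo : mu setT < +oo by rewrite (le_lt_trans mu1)// ltry.
have nuoo : nu setT < +oo.
  rewrite (@le_lt_trans _ _ 1) ?ltry// -(probability_setT P) -munu//.
  by rewrite leeDr.
have nuT : 1 - mu setT = nu setT.
  rewrite -(probability_setT P) -munu// addeAC subee ?add0e//.
  by rewrite ge0_fin_numE.
(* The default [P] is reached only when [nu] is null, and then its coefficient is 0. *)
exists mu, (mnormalize nu P); split => // A mA.
by rewrite nuT !mnormalizeK// munu.
Qed.

Lemma coupling_product (R : realType) (d : measure_display)
    (T : measurableType d) (P P' : probability T R) :
  coupling P P' (P \x P').
Proof.
move=> A mA; split.
- rewrite /pushforward (_ : fst @^-1` A = A `*` setT); last first.
    by apply/seteqP; split => [[x y]|[x y] []].
  by rewrite [LHS]product_measure1E// [X in _ * X](probability_setT P') mule1.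
- rewrite /pushforward (_ : snd @^-1` A = setT `*` A); last first.
    by apply/seteqP; split => [[x y]|[x y] []].
  by rewrite [LHS]product_measure1E// [X in X * _](probability_setT P) mul1e.
Qed.

(** * Consequences of quasi-strong duality, and the coupling bound *)

Section Duality.
Context (R : realType) (d : measure_display) (T : measurableType d).
Variables (E : set (T * T)) (G : set (set T)).
Hypotheses (mE : measurable E) (hG : is_sub_sigma_algebra G).

(** The Dirac mass at (x, y) couples those at x and y and is carried by [E], so the latter two agree
    on [G]. *)
Lemma quasi_strong_duality_invariant (A : set T) (x y : T) :
  quasi_strong_duality R E G -> G A -> E (x, y) -> A x -> A y.
Proof.
move=> qsd GA Exy Ax.
have mA : measurable A by exact: hG.2.
have /(_ A GA) : forall B, G B -> dirac x B = dirac y B :> \bar R.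
  apply: (qsd (dirac x) (dirac y)).2.
  exists (dirac (x, y) : probability (T * T)%type R).
    by move=> B mB; rewrite /pushforward/= !diracE.
  apply/negligibleP; first exact: measurableC.
  by rewrite /= diracE memNset//= => /(_ Exy).
rewrite !diracE mem_set//= => -[] /eqP; rewrite eq_sym pnatr_eq1 eqb1.
by rewrite inE.
Qed.

Lemma coupling_lower_bound (P P' : probability T R)
    (Q : probability (T * T)%type R) (A : set T) :
  (forall x y, E (x, y) -> A x -> A y) -> measurable A ->
  coupling P P' Q -> P A - P' A <= 1 - Q E.
Proof.
move=> AE mA PP'Q; have [<- <-] := PP'Q A mA; rewrite /pushforward.
have m1 : measurable (fst @^-1` A : set (T * T)).
  by rewrite -[X in measurable X]setTI; exact: measurable_fst.
have m2 : measurable (snd @^-1` A : set (T * T)).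
  by rewrite -[X in measurable X]setTI; exact: measurable_snd.
rewrite -probability_setC// leeBlDl; last exact: fin_num_measure.
(* Invariance places the event that the first coordinate lies in [A] inside this union;
   subadditivity then bounds the union. *)
apply: (@le_trans _ _ (Q ((snd @^-1` A) `|` ~` E))).
  apply: le_measure; rewrite ?inE//.
    by apply: measurableU => //; exact: measurableC.
  move=> [x y] /= Ax; have [Exy|] := pselect (E (x, y)); last by right.
  by left; exact: AE Exy Ax.
by apply: measureU2 => //; exact: measurableC.
Qed.

Lemma quasi_strong_duality_attained (P P' : probability T R) :
  quasi_strong_duality R E G ->
  exists2 A, G A & exists2 Q, coupling P P' Q & 1 - Q E <= P A - P' A.
Proof.
(* [S] is the same set with the sigma-algebra [G]; the image of a probability under the identity [i]
   is its restriction to [G]. *)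
move=> qsd; pose S : measurableType _ := g_sigma_algebraType G.
have mSE : @measurable _ S = G by exact: measurable_g_measurableTypeE hG.1.
have mS (B : set T) : G B -> measurable (B : set S) by rewrite mSE.
have mi : measurable_fun setT (id : T -> S).
  by move=> _ B; rewrite mSE setTI; exact: hG.2.
pose i : {mfun T >-> S} :=
  HB.pack (id : T -> S) (isMeasurableFun.Build _ _ _ _ _ mi).
have [g [g' [A [[mg g01] [mg' g'01] gg' mA massA]]]] :=
  probability_overlap (distribution P i) (distribution P' i).
have int_i (Q : probability T R) (f : S -> R) (B : set T) : G B ->
    measurable_fun setT f -> (forall x, 0 <= f x <= 1)%R ->
    \int[distribution Q i]_(x in B) (f x)%:E = \int[Q]_(x in B) (f x)%:E.
  move=> /mS mB mf f01.
  rewrite [LHS]ge0_integral_pushforward//.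
  - exact/measurable_EFinP/measurable_funTS.
  - by move=> x _; rewrite lee_fin; have /andP[] := f01 x.
(* The weights are measurable for [G], but they now act on [P] and [P'] over the full sigma-algebra;
   [mu] and [mu'] need only agree on [G]. *)
have [mu [P2 [muE mu1 PE]]] :=
  probability_density_split (g := g) P P (measurableT_comp mg mi) g01.
have [mu' [P2' [mu'E _ P'E]]] :=
  probability_density_split (g := g') P' P (measurableT_comp mg' mi) g'01.
have GT : G setT by rewrite -mSE; exact: measurableT.
have mu'G B : G B -> mu' B = mu B.
  by move=> GB; rewrite muE mu'E -!int_i// gg'//; exact: mS.
(* The default [P] is shared so that the normalizations agree on [G] even if the
   overlap is null. *)
have [Q1 Q1P Q1E] : exists2 Q : probability (T * T)%type R,
    coupling (mnormalize mu P) (mnormalize mu' P) Q & Q.-negligible (~` E).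
  apply: (qsd _ _).1 => B GB /=; rewrite /mnormalize mu'G//.
  by case: ifP; rewrite ?mu'G.
(* The weight is the common mass, equal to [mu' setT] since [setT] is in [G]; hence the marginals of
   the mixture are the two splits [PE] and [P'E]. *)
have [Q QE] := mixture_probability (p := mu setT) Q1 (P2 \x P2')
  (introT andP (conj (measure_ge0 mu setT) mu1)).
exists A; first by rewrite -mSE.
exists Q.
  move=> B mB; have [Q1B Q1B'] := Q1P B mB.
  have [P2B P2B'] := coupling_product P2 P2' mB.
  rewrite /pushforward !QE; split.
  - by rewrite PE//; congr (_ * _ + _ * _).
  - by rewrite P'E// mu'G//; congr (_ * _ + _ * _).
rewrite [leRHS](_ : _ = 1 - mu setT); last by rewrite -[LHS]massA int_i// muE.
have Q1E1 : Q1 E = 1.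
  have : Q1 (~` E) = 0 by exact: measure_negligible (measurableC mE) Q1E.
  rewrite probability_setC// => /eqP.
  by rewrite sube_eq ?add0e ?fin_num_measure// => /eqP.
(* The component [Q1] alone contributes [mu setT] to [Q E]; the product component contributes a
   nonnegative amount. *)
by rewrite leeB// QE Q1E1 mule1 leeDl// mule_ge0// sube_ge0// orbT.
Qed.

End Duality.

Theorem proposition3p9 (R : realType) (d : measure_display)
    (T : measurableType d) (E : set (T * T)) (G : set (set T))
    (hT : standard_borel R T)
    (hE : RelationClasses.Equivalence (fun x y : T => E (x, y)))
    (hG : is_sub_sigma_algebra G) :
  strong_duality R E G <-> (measurable E /\ quasi_strong_duality R E G).
Proof.
split=> [[mE sd]|[mE qsd]]; split => //.
(* If [P] and [P'] agree on [G], the common value is 0 and the minimizing coupling gives [E] full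
   mass. Conversely, a coupling carried by [E] forces [v <= 0], so every difference on [G]
   vanishes. *)
- move=> P P'; have [v [[[A GA PAv] vmax] [[Q QP Qv] vmin]]] := sd P P'.
  split=> [PP'|[Q' Q'P Q'E]].
  + exists Q => //; apply/negligibleP; first exact: measurableC.
    rewrite [LHS](probability_setC Q mE) Qv -PAv PP'// subee ?abse0//.
    by rewrite fin_num_measure//; exact: hG.2.
  + have v0 : v <= 0.
      apply: vmin; exists Q' => //.
      rewrite -probability_setC//.
      exact: measure_negligible (measurableC mE) Q'E.
    move=> B GB; have mB : measurable B by exact: hG.2.
    have : P B - P' B == 0.
      rewrite -abse_eq0 eq_le abse_ge0 andbT (le_trans _ v0)//.
      by apply: vmax; exists B.
    by rewrite sube_eq ?add0e ?fin_num_measure// => /eqP.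
- move=> P P'; have [A GA [Q QP QA]] :=
    quasi_strong_duality_attained mE hG P P' qsd.
  have dual B Q' : G B -> coupling P P' Q' -> P B - P' B <= 1 - Q' E.
    move=> GB Q'P; apply: coupling_lower_bound Q'P => //; last exact: hG.2.
    by move=> x y; exact: quasi_strong_duality_invariant qsd GB.
  (* Passing from [B] to its complement, also in [G], flips the sign of the difference, so the
     one-sided bound yields the absolute value. *)
  have dual_abs B Q' : G B -> coupling P P' Q' -> `|P B - P' B| <= 1 - Q' E.
    move=> GB Q'P; have mB : measurable B by exact: hG.2.
    have GBC : G (~` B) by rewrite -setTD; have [_ GC _] := hG.1; exact: GC.
    have := dual _ _ GBC Q'P; have := dual _ _ GB Q'P.
    rewrite !probability_setC//.
    have PB := fin_num_measure P B mB; have P'B := fin_num_measure P' B mB.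
    have Q'E := fin_num_measure Q' E mE.
    rewrite -(fineK PB) -(fineK P'B) -(fineK Q'E) -!EFinB abse_EFin !lee_fin.
    by rewrite ler_norml => ? ?; apply/andP; split; lra.
  (* The bound and its attainment pinch both sides, so [A] is the maximizer and [Q] the
     minimizer. *)
  have vE : `|P A - P' A| = 1 - Q E.
    by apply/eqP; rewrite eq_le dual_abs//= (le_trans QA)// lee_abs.
  exists (1 - Q E); split; split.
  + by exists A.
  + by move=> _ [B GB <-]; exact: dual_abs.
  + by exists Q.
  + by move=> _ [Q' Q'P <-]; rewrite -vE; exact: dual_abs.
Qed.
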